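(* Let $\lambda_0$ be a triple eigenvalue of the Sturm--Liouville problem $-y''+q(x)y=\lambda y$ $(0<x<1)$, $y(0)\cos\beta=y'(0)\sin\beta$, $(a\lambda+b)y(1)=(c\lambda+d)y'(1)$, where $q$ is real-valued and continuous on $[0,1]$, $a,b,c,d\in\mathbb{R}$, $ad-bc<0$ and $0\le\beta<\pi$. Let $\omega$ be its characteristic function, let $y_0$ be the eigenfunction, let $y_1=\tilde y_1+Cy_0$ and $y_2=\tilde y_2+C\tilde y_1+Dy_0$ be the first and second associated functions with constants $C$ and $D$, and let $y_2^{\#}=y_2+C_2y_1+D_1y_0$, where $C_2$ and $D_1$ are the specific constants defined in the context. Then $\mathfrak{A}(y_2^{\#})=0$ if and only if $$D=C^2+\frac{\omega^{IV}(\lambda_0)}{4\,\omega'''(\lambda_0)}\left(C+\frac{\omega^{IV}(\lambda_0)}{4\,\omega'''(\lambda_0)}\right)-\frac{\omega^{V}(\lambda_0)}{20\,\omega'''(\lambda_0)}.$$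
   Context: Setting. Let $q$ be a real-valued continuous function on $[0,1]$, let $a,b,c,d$ be reals with $ad-bc<0$, and let $0\le\beta<\pi$. Consider the problem $$-y''+q(x)y=\lambda y\ (0<x<1),\qquad y(0)\cos\beta=y'(0)\sin\beta,\qquad (a\lambda+b)y(1)=(c\lambda+d)y'(1).$$ Let $y(x,\lambda)$ be the solution of $-y''+q(x)y=\lambda y$ with initial data $y(0,\lambda)=\sin\beta$, $y'(0,\lambda)=\cos\beta$ (a prime on $y$-functions denotes $d/dx$). The characteristic function is $$\omega(\lambda)=(a\lambda+b)\,y(1,\lambda)-(c\lambda+d)\,y'(1,\lambda),$$ whose derivatives $\omega',\omega'',\omega''',\omega^{IV},\omega^{V}$ are taken with respect to $\lambda$. Eigenvalues are the zeros of $\omega$, with multiplicity the order of the zero; $\lambda_0$ is a triple eigenvalue if $\omega(\lambda_0)=\omega'(\lambda_0)=\omega''(\lambda_0)=0\ne\omega'''(\lambda_0)$. Root functions. $y_0(x)=y(x,\lambda_0)$ is the eigenfunction; $\tilde y_1(x)=\frac{\partial y}{\partial\lambda}(x,\lambda_0)$, $\tilde y_2(x)=\frac12\frac{\partial^2 y}{\partial\lambda^2}(x,\lambda_0)$. For constants $C,D$, the first associated function is $y_1=\tilde y_1+Cy_0$ and the second associated function is $y_2=\tilde y_2+C\tilde y_1+Dy_0$ (they satisfy, for $j=1,2$, $-y_j''+qy_j=\lambda_0y_j+y_{j-1}$, $y_j(0)\cos\beta=y_j'(0)\sin\beta$, $(a\lambda_0+b)y_j(1)+ay_{j-1}(1)=(c\lambda_0+d)y_j'(1)+cy_{j-1}'(1)$).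 With the same constants $C,D$ put $$\hat y_1=y_1+Cy_0,\qquad \hat y_2=y_2+Cy_1+Dy_0.$$ The quantities $\mathfrak{A}$. Define $$\mathfrak{A}(y_0)=\begin{cases}\dfrac{y_0(1)}{c\lambda_0+d}, & c\lambda_0+d\neq0,\\[8pt] \dfrac{y_0'(1)}{a\lambda_0+b}, & c\lambda_0+d=0.\end{cases}$$ For $u$ equal to any of $y_1,\hat y_1,y_1^{\#}$, $$\mathfrak{A}(u)=\begin{cases}\dfrac{u(1)}{c\lambda_0+d}-\dfrac{c\,y_0(1)}{(c\lambda_0+d)^2}, & c\lambda_0+d\neq0,\\[8pt] \dfrac{u'(1)}{a\lambda_0+b}-\dfrac{a\,y_0'(1)}{(a\lambda_0+b)^2}, & c\lambda_0+d=0.\end{cases}$$ For the pairs $(v,u)=(y_2,y_1)$, $(\hat y_2,\hat y_1)$, $(y_2^{*},y_1^{\#})$, $(y_2^{\#},y_1^{\#})$ (where $u$ is the function attached to $v$), $$\mathfrak{A}(v)=\begin{cases}\dfrac{v(1)}{c\lambda_0+d}-\dfrac{c\,u(1)}{(c\lambda_0+d)^2}+\dfrac{c^2y_0(1)}{(c\lambda_0+d)^3}, & c\lambda_0+d\neq0,\\[8pt] \dfrac{v'(1)}{a\lambda_0+b}-\dfrac{a\,u'(1)}{(a\lambda_0+b)^2}+\dfrac{a^2y_0'(1)}{(a\lambda_0+b)^3}, & c\lambda_0+d=0.\end{cases}$$ The functions $y_1^{\#},y_2^{*},y_2^{\#}$. Put $y_1^{\#}=y_1+C_2y_0$, $y_2^{*}=y_2+C_2y_1$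 and $y_2^{\#}=y_2^{*}+D_1y_0$, where $$C_2=-\frac{\mathfrak{A}(\hat y_1)\,\frac{\omega'''(\lambda_0)}{6}+\mathfrak{A}(y_0)\,\frac{\omega^{IV}(\lambda_0)}{24}}{\mathfrak{A}(y_0)\,\frac{\omega'''(\lambda_0)}{6}},$$ $$D_1=-\frac{\mathfrak{A}(\hat y_2)\,\frac{\omega'''(\lambda_0)}{6}+\mathfrak{A}(\hat y_1)\,\frac{\omega^{IV}(\lambda_0)}{24}+\mathfrak{A}(y_0)\,\frac{\omega^{V}(\lambda_0)}{120}-C_2^2\,\mathfrak{A}(y_0)\,\frac{\omega'''(\lambda_0)}{6}}{\mathfrak{A}(y_0)\,\frac{\omega'''(\lambda_0)}{6}}.$$ *)

(* Defs.v *)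
From Stdlib Require Import Reals.
From Coquelicot Require Import Coquelicot.

Open Scope C_scope.

(* The spectral parameter, the solutions y(., lambda) and the constants of the
   root functions are complex; q, a, b, c, d and beta are real. *)

Definition I01 (x : R) : Prop := (0 <= x <= 1)%R.

(* Differentiation in x of a function given on [0,1]: the difference quotient is
   restricted to [0,1], so the derivative is one-sided at 0 and at 1. *)
Definition is_dx (u : R -> C) (x : R) (l : C) : Prop :=
  filterlim (fun t : R => (u t - u x) / RtoC (t - x))
    (within I01 (locally' x)) (locally l).

Definition ex_dx (u : R -> C) (x : R) : Prop := exists l : C, is_dx u x l.

(* Total operator: the unique l with [is_dx u x l], when there is one. *)
Definition dx (u : R -> C) (x : R) : C :=
  iota (T := C_CompleteNormedModule) (is_dx u x).

(* [C_derive] evaluates the limit along the real direction; it is the complex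
   derivative of f at every point where f is complex differentiable. *)
Definition C_derive_n (f : C -> C) (n : nat) : C -> C := Nat.iter n C_derive f.

Record is_solution (q : R -> R) (beta : R) (lambda : C) (u : R -> C) : Prop := {
  sol_C1_diff : forall x, I01 x -> ex_dx u x;
  sol_C1_cont : continuous_on I01 (dx u);
  sol_diff2   : forall x, (0 < x < 1)%R -> ex_dx (dx u) x;
  sol_ode     : forall x, (0 < x < 1)%R ->
                  - dx (dx u) x + RtoC (q x) * u x = lambda * u x;
  sol_init    : u 0%R = RtoC (sin beta);
  sol_init'   : dx u 0%R = RtoC (cos beta)
}.

Definition omega (a b c d : R) (y : R -> C -> C) (lambda : C) : C :=
  (a * lambda + b) * y 1%R lambda
  - (c * lambda + d) * dx (fun x => y x lambda) 1%R.

Definition triple_eigenvalue (om : C -> C) (l0 : C) : Prop :=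
  om l0 = 0 /\ C_derive_n om 1 l0 = 0 /\ C_derive_n om 2 l0 = 0 /\
  C_derive_n om 3 l0 <> 0.

(* The quantity A, separately for the eigenfunction, for a first associated
   function u, and for a second associated function v with attached u.
   When c * l0 + d = 0, a * l0 + b is nonzero because ad - bc <> 0. *)
Definition frakA0 (a b c d : R) (l0 : C) (y0 : R -> C) : C :=
  if Ceq_dec (c * l0 + d) 0
  then dx y0 1%R / (a * l0 + b)
  else y0 1%R / (c * l0 + d).

Definition frakA1 (a b c d : R) (l0 : C) (y0 u : R -> C) : C :=
  if Ceq_dec (c * l0 + d) 0
  then dx u 1%R / (a * l0 + b) - a * dx y0 1%R / (a * l0 + b) ^ 2
  else u 1%R / (c * l0 + d) - c * y0 1%R / (c * l0 + d) ^ 2.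

Definition frakA2 (a b c d : R) (l0 : C) (y0 u v : R -> C) : C :=
  if Ceq_dec (c * l0 + d) 0
  then dx v 1%R / (a * l0 + b) - a * dx u 1%R / (a * l0 + b) ^ 2
       + a ^ 2 * dx y0 1%R / (a * l0 + b) ^ 3
  else v 1%R / (c * l0 + d) - c * u 1%R / (c * l0 + d) ^ 2
       + c ^ 2 * y0 1%R / (c * l0 + d) ^ 3.

(* Main.v *)
Require Import Defs.
From Stdlib Require Import Reals Lra Psatz.
From Coquelicot Require Import Coquelicot.
Open Scope C_scope.

(* If c l0 + d <> 0, the values of A on combinations of y0, y1t, y2t are linear in the
   Taylor coefficients f0 = A(y0), f1, f2 at l0 of y(1,.)/(c . + d); if c l0 + d = 0,
   the same holds with y'(1,.)/(a . + b).  Inserting C2 and D1, the terms in f1 and f2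
   cancel and A(y2#) = (C^2 + r (C + r) - s - D) f0 with r = w4/(4 w3), s = w5/(20 w3).

   Two analytic facts are needed.  First f0 <> 0: otherwise the boundary condition
   gives y0(1) = y0'(1) = 0, and an energy (Gronwall) estimate run backwards forces
   y0(0) = y0'(0) = 0.  Second, when c l0 + d = 0, the parameter derivatives of y must
   be differentiable in x at 1: their difference quotients solve inhomogeneous
   equations with zero initial data, so the energy estimate makes them Cauchy in C^1. *)

(** * Continuity on the closed interval [0,1] *)

(* Precomposition with [clamp] extends a function on [0,1] to the whole line, so that
   the two-sided continuity notions of the libraries apply. *)
Definition clamp (x : R) : R := Rmax 0 (Rmin 1 x).

Lemma clamp_I01 (x : R) : I01 (clamp x).
Proof.
  unfold I01, clamp; split.
  - apply Rmax_l.
  - apply Rmax_lub; [lra | apply Rmin_l].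
Qed.

Lemma clamp_id (x : R) : I01 x -> clamp x = x.
Proof.
  intros [H0 H1]; unfold clamp.
  rewrite Rmin_right by lra; now apply Rmax_right.
Qed.

Lemma clamp_dist (x y : R) : (Rabs (clamp x - clamp y) <= Rabs (x - y))%R.
Proof.
  unfold clamp, Rmax, Rmin.
  repeat destruct Rle_dec; unfold Rabs; repeat destruct Rcase_abs; lra.
Qed.

Definition contI {V : UniformSpace} (u : R -> V) : Prop :=
  forall x : R, continuous (fun t => u (clamp t)) x.

(** [clamp] is a 1-Lipschitz retraction onto [0,1], so a neighbourhood taken within [0,1] pulls back
    to a full neighbourhood on the line. *)
Lemma contI_continuous_on {V : UniformSpace} (u : R -> V) :
  continuous_on I01 u -> contI u.
Proof.
  intros Hu x.
  apply (filterlim_comp _ _ _ clamp u _ (within I01 (locally (clamp x)))).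
  2: apply Hu, clamp_I01.
  intros P [e He]; exists e; intros t Ht.
  apply He; [| apply clamp_I01].
  change (Rabs (clamp t - clamp x) < e)%R.
  apply Rle_lt_trans with (2 := Ht), clamp_dist.
Qed.

(** * Complex modulus and limits *)

Lemma Rabs_fst_Cmod (z : C) : (Rabs (fst z) <= Cmod z)%R.
Proof. apply Rle_trans with (2 := Rmax_Cmod z), Rmax_l. Qed.

Lemma Rabs_snd_Cmod (z : C) : (Rabs (snd z) <= Cmod z)%R.
Proof. apply Rle_trans with (2 := Rmax_Cmod z), Rmax_r. Qed.

Lemma Cmod_le_Rabs_plus (z : C) : (Cmod z <= Rabs (fst z) + Rabs (snd z))%R.
Proof.
  unfold Cmod.
  rewrite <- (sqrt_pow2 (Rabs (fst z) + Rabs (snd z))).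
  2: generalize (Rabs_pos (fst z)) (Rabs_pos (snd z)); lra.
  apply sqrt_le_1_alt.
  rewrite <- (pow2_abs (fst z)), <- (pow2_abs (snd z)).
  generalize (Rabs_pos (fst z)) (Rabs_pos (snd z)); nra.
Qed.

Lemma Cmod_sqr (z : C) : (Cmod z ^ 2 = fst z ^ 2 + snd z ^ 2)%R.
Proof.
  unfold Cmod; rewrite pow2_sqrt; [reflexivity |].
  generalize (pow2_ge_0 (fst z)) (pow2_ge_0 (snd z)); lra.
Qed.

Lemma Cmod_triangle3 (x y z : C) : (Cmod (x + y + z) <= Cmod x + Cmod y + Cmod z)%R.
Proof.
  eapply Rle_trans; [apply Cmod_triangle |].
  generalize (Cmod_triangle x y); lra.
Qed.

Lemma ball_C_of_Cmod (x y : C) (e : R) : (Cmod (y - x) < e)%R -> ball x e y.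
Proof. exact (C_NormedModule_mixin_compat1 x y e). Qed.

(** Balls of [C] are taken coordinatewise; passing to the modulus costs a factor sqrt 2, rounded up
    to 2. *)
Lemma Cmod_of_ball_C (x y : C) (e : posreal) :
  ball x e y -> (Cmod (y - x) < 2 * e)%R.
Proof.
  intros H; eapply Rlt_trans.
  - exact (C_NormedModule_mixin_compat2 x y e H).
  - apply Rmult_lt_compat_r; [apply cond_pos |].
    apply sqrt_less; lra.
Qed.

Lemma filterlim_C_Cmod {T} {F : (T -> Prop) -> Prop} {FF : Filter F}
  (f : T -> C) (l : C) :
  filterlim f F (locally l) <->
  (forall e : R, (0 < e)%R -> F (fun t => (Cmod (f t - l) <= e)%R)).
Proof.
  split; intros H.
  - intros e He.
    assert (He2 : (0 < e / 2)%R) by lra.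
    generalize (proj1 (filterlim_locally f l) H (mkposreal _ He2)).
    apply filter_imp; intros t Ht.
    apply Cmod_of_ball_C in Ht; simpl in Ht; lra.
  - apply filterlim_locally; intros e.
    assert (He2 : (0 < e / 2)%R) by (generalize (cond_pos e); lra).
    generalize (H _ He2); apply filter_imp; intros t Ht.
    apply ball_C_of_Cmod; lra.
Qed.

(** * Differentiation on [0,1], one-sided at the endpoints *)

(** Division-free form of [is_dx]: the case [t = x] holds trivially, so no punctured neighbourhood
    has to be carried through the estimates. *)
Definition dI (u : R -> C) (x : R) (l : C) : Prop :=
  forall e : R, (0 < e)%R -> exists del : R, (0 < del)%R /\
  forall t : R, I01 t -> (Rabs (t - x) < del)%R ->
  (Cmod (u t - u x - l * (t - x)%R) <= e * Rabs (t - x))%R.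

Lemma RtoC_neq_0 (x : R) : x <> 0%R -> RtoC x <> 0.
Proof. intros H E; apply H, (f_equal fst E). Qed.

Lemma is_dx_dI (u : R -> C) (x : R) (l : C) : is_dx u x l <-> dI u x l.
Proof.
  unfold is_dx; rewrite filterlim_C_Cmod; unfold within, locally'.
  split; intros H e He.
  - destruct (H e He) as [del Hd].
    exists del; split; [apply cond_pos |]; intros t It Ht.
    destruct (Req_dec t x) as [-> | Hne].
    + rewrite Rminus_diag, Rabs_R0, Rmult_0_r.
      replace (u x - u x - l * 0%R) with (RtoC 0) by ring.
      rewrite Cmod_0; lra.
    + assert (Hn : RtoC (t - x) <> 0) by (apply RtoC_neq_0; lra).
      replace (u t - u x - l * (t - x)%R)
        with (((u t - u x) / (t - x)%R - l) * (t - x)%R) by (field; exact Hn).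
      rewrite Cmod_mult, Cmod_R.
      apply Rmult_le_compat_r; [apply Rabs_pos |].
      apply Hd; auto.
  - destruct (H e He) as [del [Hd0 Hd]].
    exists (mkposreal del Hd0); intros t Ht Hne It.
    assert (Hn : RtoC (t - x) <> 0) by (apply RtoC_neq_0; lra).
    assert (Hp : (0 < Rabs (t - x))%R) by (apply Rabs_pos_lt; lra).
    apply Rmult_le_reg_r with (1 := Hp).
    rewrite <- Cmod_R at 1; rewrite <- Cmod_mult.
    replace (((u t - u x) / (t - x)%R - l) * (t - x)%R)
      with (u t - u x - l * (t - x)%R) by (field; exact Hn).
    now apply Hd.
Qed.

Lemma dI_ext (u v : R -> C) (x : R) (l : C) :
  I01 x -> (forall t, I01 t -> u t = v t) -> dI u x l -> dI v x l.
Proof.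
  intros Ix E H e He; destruct (H e He) as [del [H0 Hd]].
  exists del; split; [exact H0 |]; intros t It Ht.
  rewrite <- !E by assumption; now apply Hd.
Qed.

Lemma dI_plus (u v : R -> C) (x : R) (l m : C) :
  dI u x l -> dI v x m -> dI (fun t => u t + v t) x (l + m).
Proof.
  intros Hu Hv e He.
  assert (He2 : (0 < e / 2)%R) by lra.
  destruct (Hu _ He2) as [d1 [H1 Hd1]], (Hv _ He2) as [d2 [H2 Hd2]].
  exists (Rmin d1 d2); split; [now apply Rmin_glb_lt |]; intros t It Ht.
  replace (u t + v t - (u x + v x) - (l + m) * (t - x)%R)
    with ((u t - u x - l * (t - x)%R) + (v t - v x - m * (t - x)%R)) by ring.
  eapply Rle_trans; [apply Cmod_triangle |].
  generalize (Hd1 t It (Rlt_le_trans _ _ _ Ht (Rmin_l _ _)))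
    (Hd2 t It (Rlt_le_trans _ _ _ Ht (Rmin_r _ _))); lra.
Qed.

Lemma dI_scal (k : C) (u : R -> C) (x : R) (l : C) :
  dI u x l -> dI (fun t => k * u t) x (k * l).
Proof.
  intros Hu e He.
  (* The added 1 keeps the divisor positive when [k = 0]. *)
  assert (Hk : (0 < Cmod k + 1)%R) by (generalize (Cmod_ge_0 k); lra).
  assert (He2 : (0 < e / (Cmod k + 1))%R) by now apply Rdiv_lt_0_compat.
  destruct (Hu _ He2) as [d1 [H1 Hd1]].
  exists d1; split; [exact H1 |]; intros t It Ht.
  replace (k * u t - k * u x - k * l * (t - x)%R)
    with (k * (u t - u x - l * (t - x)%R)) by ring.
  rewrite Cmod_mult.
  apply Rle_trans with (Cmod k * (e / (Cmod k + 1) * Rabs (t - x)))%R.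
  - apply Rmult_le_compat_l; [apply Cmod_ge_0 | auto].
  - apply Rle_trans with ((Cmod k + 1) * (e / (Cmod k + 1) * Rabs (t - x)))%R.
    + apply Rmult_le_compat_r; [| lra].
      apply Rmult_le_pos; [lra | apply Rabs_pos].
    + apply Req_le; field; lra.
Qed.

Lemma dI_minus (u v : R -> C) (x : R) (l m : C) :
  dI u x l -> dI v x m -> dI (fun t => u t - v t) x (l - m).
Proof.
  intros Hu Hv.
  replace (l - m) with (l + (- RtoC 1) * m) by ring.
  intros e He.
  destruct (dI_plus _ _ _ _ _ Hu (dI_scal (- RtoC 1) _ _ _ Hv) e He) as [d [Hd H]].
  exists d; split; [exact Hd |]; intros t It Ht.
  replace (u t - v t - (u x - v x))
    with (u t + - RtoC 1 * v t - (u x + (- RtoC 1) * v x)) by ring.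
  now apply H.
Qed.

Lemma dI_continuous_on (u p : R -> C) :
  (forall x, I01 x -> dI u x (p x)) -> continuous_on I01 u.
Proof.
  intros Hu x Ix; apply filterlim_C_Cmod; intros e He.
  destruct (Hu x Ix 1%R Rlt_0_1) as [d [Hd H]].
  assert (Hk : (0 < Cmod (p x) + 1)%R) by (generalize (Cmod_ge_0 (p x)); lra).
  assert (He2 : (0 < Rmin d (e / (Cmod (p x) + 1)))%R)
    by (apply Rmin_glb_lt; [exact Hd | now apply Rdiv_lt_0_compat]).
  exists (mkposreal _ He2); intros t Ht It.
  change (Rabs (t - x) < Rmin d (e / (Cmod (p x) + 1)))%R in Ht.
  replace (u t - u x) with ((u t - u x - p x * (t - x)%R) + p x * (t - x)%R) by ring.
  eapply Rle_trans; [apply Cmod_triangle |].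
  rewrite Cmod_mult, Cmod_R.
  generalize (H t It (Rlt_le_trans _ _ _ Ht (Rmin_l _ _))); intros H1.
  generalize (Rlt_le_trans _ _ _ Ht (Rmin_r _ _)); intros H2.
  apply Rle_trans with ((Cmod (p x) + 1) * Rabs (t - x))%R; [lra |].
  apply Rle_trans with ((Cmod (p x) + 1) * (e / (Cmod (p x) + 1)))%R.
  - apply Rmult_le_compat_l; lra.
  - apply Req_le; field; lra.
Qed.

(** Both affine approximations are compared at one test point of [0,1] close to [x] but different
    from it. *)
Lemma dI_unique (u : R -> C) (x : R) (l m : C) :
  I01 x -> dI u x l -> dI u x m -> l = m.
Proof.
  intros Ix Hl Hm.
  assert (H : forall e : R, (0 < e)%R -> (Cmod (l - m) <= e)%R).
  { intros e He.
    assert (He2 : (0 < e / 2)%R) by lra.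
    destruct (Hl _ He2) as [d1 [H1 Hd1]], (Hm _ He2) as [d2 [H2 Hd2]].
    (* The cap 1/2 leaves room in [0,1] for a point at distance [d / 2]: to the right of [x] if
       [x <= 1/2], to the left otherwise. *)
    assert (Hd : (0 < Rmin (Rmin d1 d2) (1 / 2))%R)
      by (repeat apply Rmin_glb_lt; lra).
    set (d := (Rmin (Rmin d1 d2) (1 / 2))%R) in *.
    assert (d <= d1 /\ d <= d2 /\ d <= 1 / 2)%R as [L1 [L2 L3]].
    { unfold d, Rmin; repeat destruct Rle_dec; lra. }
    assert (exists t, I01 t /\ Rabs (t - x) = (d / 2)%R) as [t [It Ht]].
    { unfold I01 in *; destruct (Rle_dec x (1 / 2)).
      - exists (x + d / 2)%R; split; [lra |].
        rewrite Rabs_pos_eq; lra.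
      - exists (x - d / 2)%R; split; [lra |].
        rewrite Rabs_left; lra. }
    assert (G1 := Hd1 t It ltac:(lra)); assert (G2 := Hd2 t It ltac:(lra)).
    rewrite Ht in G1, G2.
    assert (G : (Cmod ((l - m) * (t - x)%R) <= e * (d / 2))%R).
    { replace ((l - m) * (t - x)%R)
        with (- (u t - u x - l * (t - x)%R) + (u t - u x - m * (t - x)%R)) by ring.
      eapply Rle_trans; [apply Cmod_triangle |]; rewrite Cmod_opp; lra. }
    rewrite Cmod_mult, Cmod_R, Ht in G.
    apply Rmult_le_reg_r with (2 := G); lra. }
  assert (Z : Cmod (l - m) = 0%R).
  { apply Rle_antisym; [| apply Cmod_ge_0].
    apply Rnot_lt_le; intros Hp; assert (Hp2 := H (Cmod (l - m) / 2)%R ltac:(lra)); lra. }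
  apply Cmod_eq_0 in Z.
  replace l with (l - m + m) by ring; rewrite Z; ring.
Qed.

Lemma dx_dI (u : R -> C) (x : R) (l : C) : I01 x -> dI u x l -> dx u x = l.
Proof.
  intros Ix H; apply (iota_unique (V := C_CompleteNormedModule)).
  - intros m Hm; apply is_dx_dI in Hm; now apply (dI_unique u x).
  - now apply is_dx_dI.
Qed.

Lemma dI_derivable_pt_lim (u : R -> C) (x : R) (l : C) :
  (0 < x < 1)%R -> dI u x l ->
  derivable_pt_lim (fun t => fst (u t)) x (fst l) /\
  derivable_pt_lim (fun t => snd (u t)) x (snd l).
Proof.
  intros Hx Hu.
  (* Real and imaginary parts are treated at once: [pr] is any real-homogeneous, subtractive map
     bounded by the modulus. *)
  assert (H : forall pr : C -> R,
    (forall z, (Rabs (pr z) <= Cmod z)%R) ->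
    (forall z z', pr (z - z') = (pr z - pr z')%R) ->
    (forall z (r : R), pr (z * r) = (pr z * r)%R) ->
    derivable_pt_lim (fun t => pr (u t)) x (pr l)).
  { intros pr Hpr Hm Hs e He.
    assert (He2 : (0 < e / 2)%R) by lra.
    destruct (Hu _ He2) as [d [Hd H]].
    assert (Hd2 : (0 < Rmin d (Rmin x (1 - x)))%R)
      by (repeat apply Rmin_glb_lt; lra).
    exists (mkposreal _ Hd2); simpl; intros h Hh Hhd.
    assert (Rabs h < d /\ Rabs h < x /\ Rabs h < 1 - x)%R as [B1 [B2 B3]].
    { revert Hhd; unfold Rmin; repeat destruct Rle_dec; lra. }
    assert (I : I01 (x + h)).
    { unfold I01; apply Rabs_def2 in B2; apply Rabs_def2 in B3; lra. }
    assert (G := H (x + h)%R I); replace (x + h - x)%R with h in G by ring.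
    specialize (G B1); apply (Rle_trans _ _ _ (Hpr _)) in G.
    rewrite !Hm, Hs in G.
    assert (Hp : (0 < Rabs h)%R) by now apply Rabs_pos_lt.
    apply Rmult_lt_reg_r with (1 := Hp); rewrite <- Rabs_mult.
    replace (((pr (u (x + h)) - pr (u x)) / h - pr l) * h)%R
      with (pr (u (x + h)%R) - pr (u x) - pr l * h)%R by (field; exact Hh).
    nra. }
  split; apply H.
  - apply Rabs_fst_Cmod.
  - reflexivity.
  - intros z r; simpl; ring.
  - apply Rabs_snd_Cmod.
  - reflexivity.
  - intros z r; simpl; ring.
Qed.

(** * Monotonicity, closure properties and boundedness on [0,1] *)

Lemma contI_nondecr (f df : R -> R) :
  contI f ->
  (forall x, (0 < x < 1)%R -> derivable_pt_lim f x (df x)) ->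
  (forall x, (0 < x < 1)%R -> (0 <= df x)%R) ->
  forall s t, I01 s -> I01 t -> (s <= t)%R -> (f s <= f t)%R.
Proof.
  intros Hc Hd Hp s t Is It Hst.
  (* The mean value theorem may return an endpoint, where the sign of [df] is unknown; [dg] takes
     the value 0 there. *)
  set (dg := fun x => if Rlt_dec 0 x then if Rlt_dec x 1 then df x else 0%R else 0%R).
  destruct (MVT_gen (fun x => f (clamp x)) s t dg) as [c [Hc1 Hc2]].
  - rewrite Rmin_left, Rmax_right by exact Hst; intros x Hx.
    unfold I01 in *.
    unfold dg; destruct (Rlt_dec 0 x); [| lra]; destruct (Rlt_dec x 1); [| lra].
    apply is_derive_ext_loc with f.
    + assert (H2 : (0 < Rmin x (1 - x))%R) by (apply Rmin_glb_lt; lra).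
      exists (mkposreal _ H2); intros y Hy.
      change (Rabs (y - x) < Rmin x (1 - x))%R in Hy.
      rewrite clamp_id; [reflexivity |].
      assert (Rabs (y - x) < x /\ Rabs (y - x) < 1 - x)%R as [B2 B3].
      { revert Hy; unfold Rmin; destruct Rle_dec; lra. }
      unfold I01; apply Rabs_def2 in B2; apply Rabs_def2 in B3; lra.
    + apply is_derive_Reals; apply Hd; lra.
  - intros x _; apply continuity_pt_filterlim; apply Hc.
  - rewrite !clamp_id in Hc2 by assumption.
    assert (0 <= dg c)%R.
    { unfold dg; destruct (Rlt_dec 0 c); [| lra]; destruct (Rlt_dec c 1); [| lra].
      apply Hp; lra. }
    nra.
Qed.

Lemma contI_fst (u : R -> C) : contI u -> contI (fun t => fst (u t)).
Proof.
  intros H x; apply (continuous_comp (fun t => u (clamp t)) fst); [apply H |].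
  apply continuous_fst.
Qed.

Lemma contI_snd (u : R -> C) : contI u -> contI (fun t => snd (u t)).
Proof.
  intros H x; apply (continuous_comp (fun t => u (clamp t)) snd); [apply H |].
  apply continuous_snd.
Qed.

Lemma contI_Rplus (f g : R -> R) :
  contI f -> contI g -> contI (fun t => f t + g t)%R.
Proof.
  intros Hf Hg x.
  exact (continuous_plus (fun t => f (clamp t)) (fun t => g (clamp t)) x (Hf x) (Hg x)).
Qed.

Lemma contI_Rmult (f g : R -> R) :
  contI f -> contI g -> contI (fun t => f t * g t)%R.
Proof.
  intros Hf Hg x.
  exact (continuous_mult (fun t => f (clamp t)) (fun t => g (clamp t)) x (Hf x) (Hg x)).
Qed.

Lemma contI_of_continuity (f : R -> R) : continuity f -> contI f.
Proof.
  intros Hf; apply contI_continuous_on; intros x _.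
  intros P HP.
  apply (filter_le_within I01).
  apply (proj1 (continuity_pt_filterlim f x) (Hf x)); exact HP.
Qed.

Lemma contI_bounded (u : R -> C) :
  contI u -> exists B : R, (0 <= B)%R /\ forall x, I01 x -> (Cmod (u x) <= B)%R.
Proof.
  intros Hu.
  destruct (bounded_continuity (V := C_NormedModule) (fun t => u (clamp t)) 0 1)
    as [M HM].
  { intros x _; exact (Hu x). }
  exists (Rmax 0 M); split; [apply Rmax_l |]; intros x Ix.
  assert (H := HM x Ix); rewrite clamp_id in H by exact Ix.
  apply Rlt_le in H; exact (Rle_trans _ _ _ H (Rmax_r _ _)).
Qed.

Lemma contI_bounded_R (f : R -> R) :
  contI f -> exists B : R, (0 <= B)%R /\ forall x, I01 x -> (Rabs (f x) <= B)%R.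
Proof.
  intros Hu.
  destruct (bounded_continuity (fun t => f (clamp t)) 0 1) as [M HM].
  { intros x _; exact (Hu x). }
  exists (Rmax 0 M); split; [apply Rmax_l |]; intros x Ix.
  assert (H := HM x Ix); rewrite clamp_id in H by exact Ix.
  apply Rlt_le in H; exact (Rle_trans _ _ _ H (Rmax_r _ _)).
Qed.

(** * Gronwall inequalities, forward and backward *)

Lemma exp_nondecr (x y : R) : (x <= y)%R -> (exp x <= exp y)%R.
Proof.
  intros [H | ->]; [left; now apply exp_increasing | apply Rle_refl].
Qed.

(** With the integrating factor [e t = exp (- K t)], which is at most 1, the function
    [B t - E t e t] is nondecreasing. Comparing its values at 0 and [x] bounds [E x e x] by
    [E 0 + B]. *)
Lemma gronwall (E dE : R -> R) (K B : R) :
  contI E -> (0 <= K)%R -> (0 <= B)%R ->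
  (forall x, (0 < x < 1)%R -> derivable_pt_lim E x (dE x)) ->
  (forall x, (0 < x < 1)%R -> (dE x <= K * E x + B)%R) ->
  forall x, I01 x -> (0 <= E x)%R -> (E x <= (E 0 + B) * exp K)%R.
Proof.
  intros Hc HK HB Hd Hle x Ix Ex.
  set (e := fun t => exp (- K * t)).
  assert (He : forall t, derivable_pt_lim e t (- K * e t)%R).
  { intros t; apply is_derive_Reals; unfold e; auto_derive; [trivial | ring]. }
  assert (H : (B * 0 + - 1 * (E 0 * e 0) <= B * x + - 1 * (E x * e x))%R).
  { apply (contI_nondecr (fun t => B * t + - 1 * (E t * e t))%R
      (fun t => B * 1 + - 1 * (dE t * e t + E t * (- K * e t)))%R).
    - apply contI_Rplus; [| apply contI_Rmult].
      + apply contI_of_continuity; intros t; reg.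
      + apply contI_of_continuity; intros t; reg.
      + apply contI_Rmult; [exact Hc |].
        apply contI_of_continuity; intros t; unfold e; reg.
    - intros t Ht; apply derivable_pt_lim_plus.
      + apply derivable_pt_lim_scal, derivable_pt_lim_id.
      + apply derivable_pt_lim_scal; apply derivable_pt_lim_mult; auto.
    - intros t Ht; specialize (Hle t Ht).
      assert (0 < e t)%R by apply exp_pos.
      assert (e t <= 1)%R.
      { unfold e; rewrite <- exp_0; apply exp_nondecr; nra. }
      nra.
    - unfold I01; lra.
    - exact Ix.
    - unfold I01 in Ix; lra. }
  assert (E0 : e 0%R = 1%R) by (unfold e; rewrite Rmult_0_r; apply exp_0).
  rewrite E0 in H.
  assert (Hx : (e x * exp (K * x) = 1)%R).
  { unfold e; rewrite <- exp_plus; replace (- K * x + K * x)%R with 0%R by ring.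
    apply exp_0. }
  destruct Ix as [Ix0 Ix1].
  assert (Ek : (exp (K * x) <= exp K)%R) by (apply exp_nondecr; nra).
  assert (Ekp := exp_pos (K * x)).
  assert (Ep : (0 < e x)%R) by apply exp_pos.
  assert (H2 : (E x * e x <= E 0 + B)%R) by nra.
  replace (E x) with (E x * e x * exp (K * x))%R by (rewrite Rmult_assoc, Hx; ring).
  apply Rmult_le_compat; try lra.
  now apply Rmult_le_pos; lra.
Qed.

(** The lower bound on [dE] makes [E t exp (K t)] nondecreasing, so the value at 1 controls the
    value at 0. *)
Lemma gronwall_backward (E dE : R -> R) (K : R) :
  contI E -> (0 <= K)%R ->
  (forall x, (0 < x < 1)%R -> derivable_pt_lim E x (dE x)) ->
  (forall x, (0 < x < 1)%R -> (- (K * E x) <= dE x)%R) ->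
  (E 0%R <= E 1%R * exp K)%R.
Proof.
  intros Hc HK Hd Hle.
  set (e := fun t => exp (K * t)).
  assert (He : forall t, derivable_pt_lim e t (K * e t)%R).
  { intros t; apply is_derive_Reals; unfold e; auto_derive; [trivial | ring]. }
  assert (H : (E 0 * e 0 <= E 1 * e 1)%R).
  { apply (contI_nondecr (fun t => E t * e t)%R
      (fun t => dE t * e t + E t * (K * e t))%R).
    - apply contI_Rmult; [exact Hc |].
      apply contI_of_continuity; intros t; unfold e; reg.
    - intros t Ht; apply derivable_pt_lim_mult; auto.
    - intros t Ht; specialize (Hle t Ht).
      assert (0 < e t)%R by apply exp_pos.
      nra.
    - unfold I01; lra.
    - unfold I01; lra.
    - lra. }
  unfold e in H; rewrite Rmult_0_r, exp_0, !Rmult_1_r in H; exact H.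
Qed.

(** * First-order systems with a source, and their linear combinations *)

(* First-order form of [- u'' + q u = lam u + f] with [p = u'] and bounded source [f]. *)
Record sys (q : R -> R) (lam : C) (f u p : R -> C) : Prop := {
  sys_u : forall x, I01 x -> dI u x (p x);
  sys_p : contI p;
  sys_ode : forall x, (0 < x < 1)%R -> dI p x ((q x - lam) * u x - f x);
  sys_f : exists B : R, (0 <= B)%R /\ forall x, I01 x -> (Cmod (f x) <= B)%R
}.

Lemma sys_contI_u q lam f u p : sys q lam f u p -> contI u.
Proof.
  intros H; apply contI_continuous_on, dI_continuous_on with p; apply H.
Qed.

Lemma contI_Cplus (u v : R -> C) : contI u -> contI v -> contI (fun t => u t + v t).
Proof.
  intros Hu Hv x.
  exact (continuous_plus (V := C_R_NormedModule) (fun t => u (clamp t)) (fun t => v (clamp t))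
    x (Hu x) (Hv x)).
Qed.

Lemma contI_Cscal (k : C) (u : R -> C) : contI u -> contI (fun t => k * u t).
Proof.
  intros Hu x.
  apply (continuous_scal_r (V := C_NormedModule) k (fun t => u (clamp t)) x).
  exact (Hu x).
Qed.

Lemma sys_scal q lam f u p k : sys q lam f u p ->
  sys q lam (fun t => k * f t) (fun t => k * u t) (fun t => k * p t).
Proof.
  intros [Hu Hp Ho [B [HB Hf]]]; split.
  - intros x Ix; now apply dI_scal, Hu.
  - now apply contI_Cscal.
  - intros x Hx.
    replace ((q x - lam) * (k * u x) - k * f x)
      with (k * ((q x - lam) * u x - f x)) by ring.
    now apply dI_scal, Ho.
  - exists (Cmod k * B)%R; split.
    + apply Rmult_le_pos; [apply Cmod_ge_0 | exact HB].
    + intros x Ix; rewrite Cmod_mult.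
      apply Rmult_le_compat_l; [apply Cmod_ge_0 | auto].
Qed.

Lemma sys_plus q lam f u p g v r : sys q lam f u p -> sys q lam g v r ->
  sys q lam (fun t => f t + g t) (fun t => u t + v t) (fun t => p t + r t).
Proof.
  intros [Hu Hp Ho [B [HB Hf]]] [Hv Hr Ho' [B' [HB' Hg]]]; split.
  - intros x Ix; apply dI_plus; auto.
  - now apply contI_Cplus.
  - intros x Hx.
    replace ((q x - lam) * (u x + v x) - (f x + g x))
      with (((q x - lam) * u x - f x) + ((q x - lam) * v x - g x)) by ring.
    apply dI_plus; auto.
  - exists (B + B')%R; split; [lra |].
    intros x Ix; eapply Rle_trans; [apply Cmod_triangle |].
    apply Rplus_le_compat; auto.
Qed.

Lemma sys_ext q lam f u p f' u' p' :
  (forall t, I01 t -> f t = f' t) -> (forall t, I01 t -> u t = u' t) ->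
  (forall t, I01 t -> p t = p' t) ->
  sys q lam f u p -> sys q lam f' u' p'.
Proof.
  intros Ef Eu Ep [Hu Hp Ho [B [HB Hf]]]; split.
  - intros x Ix; rewrite <- Ep by exact Ix; apply dI_ext with u; auto.
  - intros x; apply continuous_ext with (fun t => p (clamp t)); auto.
    intros t; apply Ep, clamp_I01.
  - intros x Hx; assert (Ix : I01 x) by (unfold I01; lra).
    rewrite <- Eu, <- Ef by exact Ix; apply dI_ext with p; auto.
  - exists B; split; [exact HB |]; intros x Ix; rewrite <- Ef; auto.
Qed.

Lemma sys_minus q lam f u p g v r : sys q lam f u p -> sys q lam g v r ->
  sys q lam (fun t => f t - g t) (fun t => u t - v t) (fun t => p t - r t).
Proof.
  intros H1 H2.
  eapply sys_ext.
  4: exact (sys_plus _ _ _ _ _ _ _ _ H1 (sys_scal _ _ _ _ _ (- RtoC 1) H2)).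
  all: intros t _; simpl; ring.
Qed.

(* Moves a perturbation of the spectral parameter into the source term. *)
Lemma sys_shift q lam mu f u p : sys q lam f u p ->
  sys q mu (fun t => f t + (lam - mu) * u t) u p.
Proof.
  intros H; assert (Hc := sys_contI_u _ _ _ _ _ H).
  destruct H as [Hu Hp Ho [B [HB Hf]]]; split; auto.
  - intros x Hx.
    replace ((q x - mu) * u x - (f x + (lam - mu) * u x))
      with ((q x - lam) * u x - f x) by ring; auto.
  - destruct (contI_bounded u Hc) as [B' [HB' Hu']].
    assert (HC := Cmod_ge_0 (lam - mu)).
    exists (B + Cmod (lam - mu) * B')%R; split; [nra |].
    intros x Ix; eapply Rle_trans; [apply Cmod_triangle |].
    apply Rplus_le_compat; [auto |]; rewrite Cmod_mult.
    apply Rmult_le_compat_l; auto.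
Qed.

(** * Energy estimates for the systems *)

Definition energy (u p : R -> C) (x : R) : R := (Cmod (u x) ^ 2 + Cmod (p x) ^ 2)%R.

(** Derivative of [energy] in real coordinates, with [p'] replaced by the right-hand side of the
    equation. *)
Definition denergy (q : R -> R) (lam : C) (f u p : R -> C) (x : R) : R :=
  (2 * (fst (u x) * fst (p x) + snd (u x) * snd (p x)
    + fst (p x) * fst ((q x - lam) * u x - f x)%C
    + snd (p x) * snd ((q x - lam) * u x - f x)%C))%R.

Lemma energy_eq u p x : energy u p x =
  (fst (u x) * fst (u x) + snd (u x) * snd (u x)
   + (fst (p x) * fst (p x) + snd (p x) * snd (p x)))%R.
Proof. unfold energy; rewrite !Cmod_sqr; ring. Qed.

Lemma energy_contI u p : contI u -> contI p -> contI (energy u p).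
Proof.
  intros Hu Hp x.
  apply continuous_ext with (fun t => (fst (u (clamp t)) * fst (u (clamp t))
    + snd (u (clamp t)) * snd (u (clamp t)) + (fst (p (clamp t)) * fst (p (clamp t))
    + snd (p (clamp t)) * snd (p (clamp t))))%R).
  - intros t; symmetry; apply energy_eq.
  - revert x.
    change (contI (fun t => fst (u t) * fst (u t) + snd (u t) * snd (u t)
      + (fst (p t) * fst (p t) + snd (p t) * snd (p t)))%R).
    repeat (apply contI_Rplus || apply contI_Rmult);
      (apply contI_fst || apply contI_snd); assumption.
Qed.

Lemma energy_derive q lam f u p x : sys q lam f u p -> (0 < x < 1)%R ->
  derivable_pt_lim (energy u p) x (denergy q lam f u p x).
Proof.
  intros [Hu _ Ho _] Hx.
  assert (Ix : I01 x) by (unfold I01; lra).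
  destruct (dI_derivable_pt_lim _ _ _ Hx (Hu x Ix)) as [U1 U2].
  destruct (dI_derivable_pt_lim _ _ _ Hx (Ho x Hx)) as [P1 P2].
  apply is_derive_Reals.
  apply is_derive_ext with (fun t => fst (u t) * fst (u t) + snd (u t) * snd (u t)
      + (fst (p t) * fst (p t) + snd (p t) * snd (p t)))%R.
  { intros t; symmetry; apply energy_eq. }
  apply is_derive_Reals.
  unfold denergy.
  match goal with |- derivable_pt_lim _ _ ?l => set (L := l) end.
  assert (E := derivable_pt_lim_plus _ _ _ _ _
    (derivable_pt_lim_plus _ _ _ _ _ (derivable_pt_lim_mult _ _ _ _ _ U1 U1)
      (derivable_pt_lim_mult _ _ _ _ _ U2 U2))
    (derivable_pt_lim_plus _ _ _ _ _ (derivable_pt_lim_mult _ _ _ _ _ P1 P1)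
      (derivable_pt_lim_mult _ _ _ _ _ P2 P2))).
  match type of E with derivable_pt_lim _ _ ?l => replace L with l end.
  - exact E.
  - unfold L; ring.
Qed.

Lemma Rabs_mult2_le (M k x y : R) :
  (Rabs k <= M -> 2 * Rabs (k * (x * y)) <= M * (x * x + y * y))%R.
Proof.
  intros H; rewrite !Rabs_mult.
  assert (Rabs x * Rabs x = x * x)%R by (rewrite <- Rabs_mult; apply Rabs_pos_eq; nra).
  assert (Rabs y * Rabs y = y * y)%R by (rewrite <- Rabs_mult; apply Rabs_pos_eq; nra).
  assert (Hx := Rabs_pos x); assert (Hy := Rabs_pos y); assert (Hk := Rabs_pos k).
  assert (0 <= (Rabs x - Rabs y) ^ 2)%R by apply pow2_ge_0.
  assert (0 <= Rabs x * Rabs y)%R by now apply Rmult_le_pos.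
  nra.
Qed.

(** The derivative expands into eight products, each estimated by 2|xy| <= x^2 + y^2. The products
    of [u] and [p] with coefficient 1 give one energy, those with [q - lam] give [2 M] energies, and
    those with [f] give at most one more energy plus [B ^ 2]. *)
Lemma denergy_bound q lam f u p x M B :
  (Rabs (q x) + Cmod lam <= M)%R -> (Cmod (f x) <= B)%R ->
  (Rabs (denergy q lam f u p x) <= (2 + 2 * M) * energy u p x + B ^ 2)%R.
Proof.
  intros HM HB.
  assert (Hf : (fst (f x) * fst (f x) + snd (f x) * snd (f x) <= B ^ 2)%R).
  { apply Rle_trans with (Cmod (f x) ^ 2)%R; [rewrite Cmod_sqr; nra |].
    apply pow_incr; split; [apply Cmod_ge_0 | exact HB]. }
  assert (L1 : (Rabs (q x - fst lam) <= M)%R).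
  { unfold Rminus; eapply Rle_trans; [apply Rabs_triang |]; rewrite Rabs_Ropp.
    generalize (Rabs_fst_Cmod lam); lra. }
  assert (L2 : (Rabs (snd lam) <= M)%R).
  { generalize (Rabs_snd_Cmod lam) (Rabs_pos (q x)); lra. }
  rewrite energy_eq; unfold denergy; simpl.
  destruct (u x) as [u1 u2], (p x) as [p1 p2], (f x) as [f1 f2], lam as [l1 l2];
    simpl in *.
  assert (R1 : (Rabs 1 <= 1)%R) by (rewrite Rabs_R1; lra).
  assert (A1 := Rabs_mult2_le 1 1 u1 p1 R1).
  assert (A2 := Rabs_mult2_le 1 1 u2 p2 R1).
  assert (A3 := Rabs_mult2_le 1 1 f1 p1 R1).
  assert (A4 := Rabs_mult2_le 1 1 f2 p2 R1).
  assert (A5 := Rabs_mult2_le M _ u1 p1 L1).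
  assert (A6 := Rabs_mult2_le M _ u2 p2 L1).
  assert (A7 := Rabs_mult2_le M _ u2 p1 L2).
  assert (A8 := Rabs_mult2_le M _ u1 p2 L2).
  match goal with |- (Rabs ?e <= _)%R => replace e with
    (2 * (1 * (u1 * p1)) + 2 * (1 * (u2 * p2)) - 2 * (1 * (f1 * p1))
     - 2 * (1 * (f2 * p2)) + 2 * ((q x - l1) * (u1 * p1))
     + 2 * ((q x - l1) * (u2 * p2)) + 2 * (l2 * (u2 * p1)) - 2 * (l2 * (u1 * p2)))%R
    by ring end.
  (* Both signs of every product are compared with its absolute value, after which the claim is
     linear in the products and squares. *)
  repeat match goal with H : (2 * Rabs ?z <= _)%R |- _ =>
    lazymatch goal with
    | _ : (z <= Rabs z)%R |- _ => fail
    | _ => assert (z <= Rabs z)%R by apply RRle_abs;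
           assert (- z <= Rabs z)%R by (rewrite <- Rabs_Ropp; apply RRle_abs)
    end end.
  assert (N1 := Rle_0_sqr u1); assert (N2 := Rle_0_sqr u2); unfold Rsqr in N1, N2.
  apply Rabs_le; split; lra.
Qed.

(** [K] depends only on a bound for [q] and on [L]. This uniformity in the spectral parameter is
    what permits letting [lam + h] vary later. *)
Lemma energy_bound (q : R -> R) (L : R) :
  contI q -> (0 <= L)%R ->
  exists K : R, (1 <= K)%R /\ forall lam f u p B,
    (Cmod lam <= L)%R -> sys q lam f u p -> (0 <= B)%R ->
    (forall x, I01 x -> (Cmod (f x) <= B)%R) ->
    forall x, I01 x -> (energy u p x <= (energy u p 0 + B ^ 2) * K)%R.
Proof.
  intros Hq HL.
  destruct (contI_bounded_R q Hq) as [Q [HQ Hqb]].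
  exists (exp (2 + 2 * (Q + L))); split.
  { rewrite <- exp_0; apply exp_nondecr; lra. }
  intros lam f u p B Hl H HB Hf.
  assert (HE : forall x, (0 <= energy u p x)%R).
  { intros x; unfold energy; apply Rplus_le_le_0_compat; apply pow2_ge_0. }
  intros x Ix; apply gronwall with (denergy q lam f u p); auto.
  - apply energy_contI; [exact (sys_contI_u _ _ _ _ _ H) | apply H].
  - lra.
  - apply pow2_ge_0.
  - intros t Ht; now apply energy_derive.
  - intros t Ht; assert (It : I01 t) by (unfold I01; lra).
    eapply Rle_trans; [apply RRle_abs |].
    apply denergy_bound; auto.
    generalize (Hqb t It); lra.
Qed.

(** Without a source the energy satisfies [E' >= - K E], so zero energy at 1 forces zero energy at
    0. *)
Lemma energy_backward (q : R -> R) (lam : C) (u p : R -> C) :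
  contI q -> sys q lam (fun _ => 0) u p ->
  u 1%R = 0 -> p 1%R = 0 -> u 0%R = 0 /\ p 0%R = 0.
Proof.
  intros Hq H Hu1 Hp1.
  destruct (contI_bounded_R q Hq) as [Q [HQ Hqb]].
  assert (HE : forall x, (0 <= energy u p x)%R).
  { intros x; unfold energy; apply Rplus_le_le_0_compat; apply pow2_ge_0. }
  assert (G : (energy u p 0 <= energy u p 1 * exp (2 + 2 * (Q + Cmod lam)))%R).
  { apply gronwall_backward with (denergy q lam (fun _ => 0) u p).
    - apply energy_contI; [exact (sys_contI_u _ _ _ _ _ H) | apply H].
    - generalize (Cmod_ge_0 lam); lra.
    - intros t Ht; now apply energy_derive.
    - intros t Ht; assert (It : I01 t) by (unfold I01; lra).
      assert (B := denergy_bound q lam (fun _ => 0) u p t (Q + Cmod lam) 0).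
      cbv beta in B; rewrite Cmod_0, pow_i, Rplus_0_r in B by auto.
      assert (B' : (Rabs (q t) + Cmod lam <= Q + Cmod lam)%R)
        by (generalize (Hqb t It); lra).
      specialize (B B' (Rle_refl 0)).
      apply Rabs_le_between in B; lra. }
  assert (Z : energy u p 1 = 0%R).
  { unfold energy; rewrite Hu1, Hp1, Cmod_0; ring. }
  rewrite Z, Rmult_0_l in G; unfold energy in G.
  assert (N1 := pow2_ge_0 (Cmod (u 0%R))); assert (N2 := pow2_ge_0 (Cmod (p 0%R))).
  split; apply Cmod_eq_0; apply Rsqr_0_uniq; unfold Rsqr; lra.
Qed.

(** * Uniform limits of families indexed by a real step *)

(** Uniform convergence on [0,1] as the real step [h] tends to 0; [h = 0] is excluded because the
    families are difference quotients. *)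
Definition uconv (F : R -> R -> C) (G : R -> C) : Prop :=
  forall e : R, (0 < e)%R -> exists d : R, (0 < d)%R /\
  forall h : R, h <> 0%R -> (Rabs h < d)%R ->
  forall x : R, I01 x -> (Cmod (F h x - G x) <= e)%R.

Lemma small_nonzero (d : R) : (0 < d)%R -> exists h : R, h <> 0%R /\ (Rabs h < d)%R.
Proof.
  intros Hd; exists (d / 2)%R; split; [lra |]; rewrite Rabs_pos_eq; lra.
Qed.

(** For the real part [f] of [g], and likewise for the imaginary part, both [e x + f x] and
    [e x - f x] are nondecreasing. Adding the two parts produces the factor 2. *)
Lemma dI_mean_value (g dg : R -> C) (e : R) :
  contI g -> (forall x, (0 < x < 1)%R -> dI g x (dg x)) ->
  (forall x, (0 < x < 1)%R -> (Cmod (dg x) <= e)%R) ->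
  forall s t, I01 s -> I01 t -> (Cmod (g t - g s) <= 2 * e * Rabs (t - s))%R.
Proof.
  intros Hc Hd He.
  assert (Hle : forall s t, I01 s -> I01 t -> (s <= t)%R ->
    (Cmod (g t - g s) <= 2 * e * (t - s))%R).
  { intros s t Is It Hst.
    assert (H : forall f df : R -> R, contI f ->
      (forall x, (0 < x < 1)%R -> derivable_pt_lim f x (df x)) ->
      (forall x, (0 < x < 1)%R -> (Rabs (df x) <= e)%R) ->
      (Rabs (f t - f s) <= e * (t - s))%R).
    { intros f df Hf Hdf Hb.
      assert (L : forall k : R, contI (fun x => e * x + k * f x)%R).
      { intros k; apply contI_Rplus; apply contI_Rmult; auto;
          apply contI_of_continuity; intros y; reg. }
      assert (D : forall k x : R, (0 < x < 1)%R ->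
        derivable_pt_lim (fun x => e * x + k * f x)%R x (e * 1 + k * df x)%R).
      { intros k x Hx; apply derivable_pt_lim_plus; apply derivable_pt_lim_scal; auto.
        apply derivable_pt_lim_id. }
      assert (U1 := contI_nondecr _ _ (L 1%R) (D 1%R)).
      assert (U2 := contI_nondecr _ _ (L (- (1))%R) (D (- (1))%R)).
      assert (A1 := U1 ltac:(intros x Hx; specialize (Hb x Hx); apply Rabs_le_between in Hb; lra)
        s t Is It Hst).
      assert (A2 := U2 ltac:(intros x Hx; specialize (Hb x Hx); apply Rabs_le_between in Hb; lra)
        s t Is It Hst).
      apply Rabs_le; lra. }
    eapply Rle_trans; [apply Cmod_le_Rabs_plus |].
    assert (A1 := H (fun x => fst (g x)) (fun x => fst (dg x)) (contI_fst _ Hc)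
      (fun x Hx => proj1 (dI_derivable_pt_lim _ _ _ Hx (Hd x Hx)))
      (fun x Hx => Rle_trans _ _ _ (Rabs_fst_Cmod _) (He x Hx))).
    assert (A2 := H (fun x => snd (g x)) (fun x => snd (dg x)) (contI_snd _ Hc)
      (fun x Hx => proj2 (dI_derivable_pt_lim _ _ _ Hx (Hd x Hx)))
      (fun x Hx => Rle_trans _ _ _ (Rabs_snd_Cmod _) (He x Hx))).
    simpl; unfold Rminus in *; lra. }
  intros s t Is It; destruct (Rle_dec s t).
  - rewrite Rabs_pos_eq by lra; now apply Hle.
  - rewrite Rabs_minus_sym, Rabs_pos_eq by lra.
    replace (g t - g s) with (- (g s - g t)) by ring.
    rewrite Cmod_opp; apply Hle; auto; lra.
Qed.

Lemma uconv_contI (F : R -> R -> C) (G : R -> C) :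
  (forall h, h <> 0%R -> contI (F h)) -> uconv F G -> contI G.
Proof.
  intros HF HG x; unfold continuous; apply filterlim_C_Cmod; intros e He.
  destruct (HG (e / 3)%R ltac:(lra)) as [d [Hd H]].
  destruct (small_nonzero d Hd) as [h [Hh0 Hh]].
  assert (C := HF h Hh0 x); unfold continuous in C.
  assert (C' := proj1 (filterlim_C_Cmod _ _) C (e / 3)%R ltac:(lra)).
  revert C'; apply filter_imp; intros t Ht.
  replace (G (clamp t) - G (clamp x)) with
    (- (F h (clamp t) - G (clamp t)) + (F h (clamp t) - F h (clamp x))
     + (F h (clamp x) - G (clamp x))) by ring.
  eapply Rle_trans; [apply Cmod_triangle3 |]; rewrite Cmod_opp.
  assert (H1 := H h Hh0 Hh _ (clamp_I01 t)).
  assert (H2 := H h Hh0 Hh _ (clamp_I01 x)); lra.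
Qed.

(** The mean value bound for [F h - F k], which needs derivatives only in the open interval,
    survives [k] tending to 0. Differentiability of [F h] at [x] itself, possibly an endpoint, then
    transfers to [G]. *)
Lemma uconv_dI (F dF : R -> R -> C) (G dG : R -> C) :
  (forall h, h <> 0%R -> contI (F h)) ->
  (forall h, h <> 0%R -> forall x, (0 < x < 1)%R -> dI (F h) x (dF h x)) ->
  uconv F G -> uconv dF dG ->
  forall x, I01 x -> (forall h, h <> 0%R -> dI (F h) x (dF h x)) -> dI G x (dG x).
Proof.
  intros HF HdF HG HdG x Ix Hx e He.
  destruct (HdG (e / 8)%R ltac:(lra)) as [d [Hd H]].
  destruct (small_nonzero d Hd) as [h [Hh0 Hh]].
  destruct (Hx h Hh0 (e / 8)%R ltac:(lra)) as [del [Hdel HD]].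
  exists del; split; [exact Hdel |]; intros t It Ht.
  specialize (HD t It Ht).
  assert (M : (Cmod ((F h t - G t) - (F h x - G x)) <= e / 2 * Rabs (t - x))%R).
  (* The limit in [k] is taken by contradiction: a positive [gap] is beaten by a [k] for which [F k]
     is within [gap / 4] of [G] at both [t] and [x]. *)
  { apply Rnot_lt_le; intros Hlt.
    set (gap := (Cmod ((F h t - G t) - (F h x - G x)) - e / 2 * Rabs (t - x))%R).
    assert (Hgap : (0 < gap)%R) by (unfold gap; lra).
    destruct (HG (gap / 4)%R ltac:(lra)) as [d' [Hd' H']].
    destruct (small_nonzero (Rmin d d')) as [k [Hk0 Hk]];
      [now apply Rmin_glb_lt |].
    assert (Hk1 := Rlt_le_trans _ _ _ Hk (Rmin_l _ _)).
    assert (Hk2 := Rlt_le_trans _ _ _ Hk (Rmin_r _ _)).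
    assert (MV : (Cmod ((F h t - F k t) - (F h x - F k x))
      <= 2 * (e / 4) * Rabs (t - x))%R).
    { apply (dI_mean_value (fun y => F h y - F k y) (fun y => dF h y - dF k y)); auto.
      - intros y.
        apply continuous_ext with (fun s => F h (clamp s) + (- RtoC 1) * F k (clamp s)).
        { intros s; simpl; ring. }
        apply (contI_Cplus (F h) (fun s => (- RtoC 1) * F k s)); auto.
        apply contI_Cscal; auto.
      - intros y Hy; apply dI_minus; auto.
      - intros y Hy; assert (Iy : I01 y) by (unfold I01; lra).
        replace (dF h y - dF k y) with ((dF h y - dG y) + - (dF k y - dG y)) by ring.
        eapply Rle_trans; [apply Cmod_triangle |]; rewrite Cmod_opp.
        generalize (H h Hh0 Hh y Iy) (H k Hk0 Hk1 y Iy); lra. }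
    assert (T : (Cmod ((F h t - G t) - (F h x - G x)) <=
      Cmod ((F h t - F k t) - (F h x - F k x)) + Cmod (F k t - G t)
      + Cmod (F k x - G x))%R).
    { replace ((F h t - G t) - (F h x - G x)) with
        (((F h t - F k t) - (F h x - F k x)) + (F k t - G t) + - (F k x - G x)) by ring.
      eapply Rle_trans; [apply Cmod_triangle3 |]; rewrite Cmod_opp; lra. }
    generalize (H' k Hk0 Hk2 t It) (H' k Hk0 Hk2 x Ix); unfold gap in *; lra. }
  replace (G t - G x - dG x * (t - x)%R) with
    (- ((F h t - G t) - (F h x - G x)) + (F h t - F h x - dF h x * (t - x)%R)
     + (dF h x - dG x) * (t - x)%R) by ring.
  eapply Rle_trans; [apply Cmod_triangle3 |]; rewrite Cmod_opp, Cmod_mult, Cmod_R.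
  assert (Hp := Rabs_pos (t - x)).
  assert (B := Rmult_le_compat_r _ _ _ Hp (H h Hh0 Hh x Ix)); nra.
Qed.

Lemma uconv_of_cauchy (F : R -> R -> C) :
  (forall e : R, (0 < e)%R -> exists d : R, (0 < d)%R /\
   forall h k : R, h <> 0%R -> (Rabs h < d)%R -> k <> 0%R -> (Rabs k < d)%R ->
   forall x : R, I01 x -> (Cmod (F h x - F k x) <= e)%R) ->
  exists G : R -> C, uconv F G.
Proof.
  intros HC.
  set (Fl := fun x : R => filtermap (fun h : R => (F h x : C_CompleteNormedModule))
    (locally' (0%R : R_UniformSpace))).
  assert (PF : forall x, ProperFilter (Fl x)).
  { intros x; apply filtermap_proper_filter; exact (Rbar_locally'_filter (Finite 0)). }
  exists (fun x => lim (Fl x)).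
  intros e He; destruct (HC (e / 2)%R ltac:(lra)) as [d [Hd H]].
  exists d; split; [exact Hd |]; intros h Hh0 Hh x Ix.
  assert (CF : cauchy (Fl x)).
  { intros eps; destruct (HC (eps / 2)%R) as [d' [Hd' H']].
    { generalize (cond_pos eps); lra. }
    destruct (small_nonzero d' Hd') as [k [Hk0 Hk]].
    exists (F k x); unfold Fl, filtermap.
    exists (mkposreal d' Hd'); intros y Hy Hy0.
    apply ball_C_of_Cmod.
    change (Rabs (y - 0) < d')%R in Hy; rewrite Rminus_0_r in Hy.
    generalize (H' y k Hy0 Hy Hk0 Hk x Ix) (cond_pos eps); lra. }
  assert (He4 : (0 < e / 4)%R) by lra.
  destruct (complete_cauchy (Fl x) (PF x) CF (mkposreal _ He4)) as [d' Hd'].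
  (* [k] depends on [x] through [d'], but [d] does not; this makes the convergence uniform. *)
  destruct (small_nonzero (Rmin d d')) as [k [Hk0 Hk]].
  { apply Rmin_glb_lt; [exact Hd | apply cond_pos]. }
  assert (Hk1 := Rlt_le_trans _ _ _ Hk (Rmin_l _ _)).
  assert (Hk2 := Rlt_le_trans _ _ _ Hk (Rmin_r _ _)).
  assert (B := Hd' k).
  assert (B2 : (Cmod (F k x - lim (Fl x)) < 2 * (e / 4))%R).
  { apply (Cmod_of_ball_C (lim (Fl x)) (F k x) (mkposreal _ He4)); apply B; auto.
    change (Rabs (k - 0) < d')%R; now rewrite Rminus_0_r. }
  replace (F h x - lim (Fl x)) with ((F h x - F k x) + (F k x - lim (Fl x))) by ring.
  eapply Rle_trans; [apply Cmod_triangle |].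
  generalize (H h k Hh0 Hh Hk0 Hk1 x Ix); lra.
Qed.

(** * Passage to the limit in systems with zero initial data *)

(** Since [K >= 1], [K] may replace its square root: [B ^ 2 K <= (B K) ^ 2]. *)
Lemma Cmod_le_of_energy (u p : R -> C) (x B K : R) :
  (0 <= B)%R -> (1 <= K)%R -> (energy u p x <= B ^ 2 * K)%R ->
  (Cmod (u x) <= B * K)%R /\ (Cmod (p x) <= B * K)%R.
Proof.
  unfold energy; intros HB HK H.
  assert (HBK : (0 <= B * K)%R) by nra.
  assert (HB2 := pow2_ge_0 B).
  assert (HL : (B ^ 2 * K <= (B * K) ^ 2)%R) by nra.
  assert (N1 := pow2_ge_0 (Cmod (u x))); assert (N2 := pow2_ge_0 (Cmod (p x))).
  split; apply Rsqr_incr_0_var; unfold Rsqr; lra.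
Qed.

Lemma sys_zero_init_bound (q : R -> R) (L : R) :
  contI q -> (0 <= L)%R ->
  exists K : R, (1 <= K)%R /\ forall lam f u p B,
    (Cmod lam <= L)%R -> sys q lam f u p -> u 0%R = 0 -> p 0%R = 0 -> (0 <= B)%R ->
    (forall x, I01 x -> (Cmod (f x) <= B)%R) ->
    forall x, I01 x -> (Cmod (u x) <= B * K)%R /\ (Cmod (p x) <= B * K)%R.
Proof.
  intros Hq HL; destruct (energy_bound q L Hq HL) as [K [HK H]].
  exists K; split; [exact HK |].
  intros lam f u p B Hlam Hs Hu Hp HB Hf x Ix.
  apply Cmod_le_of_energy; auto.
  assert (E := H lam f u p B Hlam Hs HB Hf x Ix).
  assert (E0 : energy u p 0 = 0%R) by (unfold energy; rewrite Hu, Hp, Cmod_0; ring).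
  rewrite E0, Rplus_0_l in E; exact E.
Qed.

Lemma uconv_at_0 (F : R -> R -> C) (G : R -> C) :
  (forall h, h <> 0%R -> F h 0%R = 0) -> uconv F G -> G 0%R = 0.
Proof.
  intros H0 HG.
  assert (I0 : I01 0) by (unfold I01; lra).
  apply Cmod_eq_0, Rle_antisym; [| apply Cmod_ge_0].
  apply Rnot_lt_le; intros Hp.
  destruct (HG (Cmod (G 0) / 2)%R ltac:(lra)) as [d [Hd H]].
  destruct (small_nonzero d Hd) as [h [Hh0 Hh]].
  specialize (H h Hh0 Hh 0%R I0); rewrite H0 in H by exact Hh0.
  replace (0 - G 0%R) with (- G 0%R) in H by ring.
  rewrite Cmod_opp in H; lra.
Qed.

(** [U h - U k] solves the system with source [F h - F k] and zero initial data, so the energy bound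
    turns convergent sources into Cauchy families [U] and [P]. *)
Lemma sys_limit (q : R -> R) (lam : C) (F U P : R -> R -> C) (G : R -> C) :
  contI q ->
  (forall h, h <> 0%R -> sys q lam (F h) (U h) (P h)) ->
  (forall h, h <> 0%R -> U h 0%R = 0) -> (forall h, h <> 0%R -> P h 0%R = 0) ->
  uconv F G ->
  (exists B : R, (0 <= B)%R /\ forall x, I01 x -> (Cmod (G x) <= B)%R) ->
  exists u p : R -> C, sys q lam G u p /\ u 0%R = 0 /\ p 0%R = 0 /\ uconv U u /\ uconv P p.
Proof.
  intros Hq HS HU0 HP0 HG HB.
  destruct (sys_zero_init_bound q (Cmod lam) Hq (Cmod_ge_0 lam)) as [K [HK HE]].
  assert (HC : forall e : R, (0 < e)%R -> exists d : R, (0 < d)%R /\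
   forall h k : R, h <> 0%R -> (Rabs h < d)%R -> k <> 0%R -> (Rabs k < d)%R ->
   forall x : R, I01 x ->
   (Cmod (U h x - U k x) <= e)%R /\ (Cmod (P h x - P k x) <= e)%R).
  { intros e He.
    (* Two sources this close to [G] differ by at most [e / K], and the energy bound multiplies this
       by [K]. *)
    assert (He2 : (0 < e / (2 * K))%R) by (apply Rdiv_lt_0_compat; lra).
    destruct (HG _ He2) as [d [Hd H]].
    exists d; split; [exact Hd |]; intros h k Hh0 Hh Hk0 Hk x Ix.
    replace e with (e / K * K)%R by (field; lra).
    apply (HE lam (fun t => F h t - F k t) (fun t => U h t - U k t)
      (fun t => P h t - P k t)); auto.
    - lra.
    - apply sys_minus; auto.
    - rewrite !HU0 by assumption; ring.
    - rewrite !HP0 by assumption; ring.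
    - apply Rlt_le, Rdiv_lt_0_compat; lra.
    - intros t It.
      replace (F h t - F k t) with ((F h t - G t) + - (F k t - G t)) by ring.
      eapply Rle_trans; [apply Cmod_triangle |]; rewrite Cmod_opp.
      replace (e / K)%R with (e / (2 * K) + e / (2 * K))%R by (field; lra).
      apply Rplus_le_compat; auto. }
  destruct (uconv_of_cauchy U) as [u Hu].
  { intros e He; destruct (HC e He) as [d [Hd H]]; exists d; split; [exact Hd |].
    intros; apply H; assumption. }
  destruct (uconv_of_cauchy P) as [p Hp].
  { intros e He; destruct (HC e He) as [d [Hd H]]; exists d; split; [exact Hd |].
    intros; apply H; assumption. }
  exists u, p; repeat split; auto.
  - intros x Ix; apply (uconv_dI U P); auto.
    + intros h Hh; exact (sys_contI_u _ _ _ _ _ (HS h Hh)).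
    + intros h Hh y Hy; apply (HS h Hh); unfold I01; lra.
    + intros h Hh; now apply (HS h Hh).
  - apply uconv_contI with P; auto.
    intros h Hh; apply (HS h Hh).
  - intros x Hx.
    apply (uconv_dI P (fun h y => (q y - lam) * U h y - F h y) p
      (fun y => (q y - lam) * u y - G y)); auto.
    + intros h Hh; apply (HS h Hh).
    + intros h Hh y Hy; now apply (HS h Hh).
    (* The derivatives of [P h] converge uniformly because the equation expresses them through [U h]
       and [F h], with [q - lam] bounded by [M]. *)
    + destruct (contI_bounded_R q Hq) as [Q [HQ Hqb]].
      intros e He.
      set (M := (Q + Cmod lam + 1)%R).
      assert (HM : (0 < M)%R) by (unfold M; generalize (Cmod_ge_0 lam); lra).
      destruct (Hu (e / (2 * M))%R) as [d1 [Hd1 H1]].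
      { apply Rdiv_lt_0_compat; lra. }
      destruct (HG (e / 2)%R ltac:(lra)) as [d2 [Hd2 H2]].
      exists (Rmin d1 d2); split; [now apply Rmin_glb_lt |].
      intros h Hh0 Hh y Iy.
      specialize (H1 h Hh0 (Rlt_le_trans _ _ _ Hh (Rmin_l _ _)) y Iy).
      specialize (H2 h Hh0 (Rlt_le_trans _ _ _ Hh (Rmin_r _ _)) y Iy).
      replace ((q y - lam) * U h y - F h y - ((q y - lam) * u y - G y))
        with ((q y - lam) * (U h y - u y) + - (F h y - G y)) by ring.
      eapply Rle_trans; [apply Cmod_triangle |]; rewrite Cmod_opp, Cmod_mult.
      assert (A : (Cmod (q y - lam) <= M)%R).
      { eapply Rle_trans; [apply Cmod_triangle |]; rewrite Cmod_opp, Cmod_R.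
        generalize (Hqb y Iy); unfold M; lra. }
      assert (A2 : (Cmod (q y - lam) * Cmod (U h y - u y) <= M * (e / (2 * M)))%R).
      { apply Rmult_le_compat; auto; apply Cmod_ge_0. }
      replace (M * (e / (2 * M)))%R with (e / 2)%R in A2 by (field; lra).
      lra.
    + unfold I01; lra.
    + intros h Hh; now apply (HS h Hh).
  - now apply uconv_at_0 with U.
  - now apply uconv_at_0 with P.
Qed.

(** Moving the parameter from [lam + h] to [lam] adds [h U h] to the source. It tends to 0
    uniformly, because the [U h] are uniformly bounded for small [h]. *)
Lemma sys_limit_shift (q : R -> R) (lam : C) (F U P : R -> R -> C) (G : R -> C) :
  contI q ->
  (forall h : R, h <> 0%R -> sys q (lam + h) (F h) (U h) (P h)) ->
  (forall h, h <> 0%R -> U h 0%R = 0) -> (forall h, h <> 0%R -> P h 0%R = 0) ->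
  uconv F G ->
  (exists B : R, (0 <= B)%R /\ forall x, I01 x -> (Cmod (G x) <= B)%R) ->
  exists u p : R -> C, sys q lam G u p /\ u 0%R = 0 /\ p 0%R = 0 /\ uconv U u /\ uconv P p.
Proof.
  intros Hq HS HU0 HP0 HG HB.
  apply sys_limit with (fun h t => F h t + (lam + h - lam) * U h t); auto.
  { intros h Hh; apply sys_shift; auto. }
  destruct HB as [B [HB HGB]].
  (* The radius [Cmod lam + 1] covers every [lam + h] with [|h| < 1]; for [|h| < d1] the source
     [F h] is within 1 of [G], hence bounded by [B + 1]. *)
  destruct (sys_zero_init_bound q (Cmod lam + 1) Hq) as [K [HK HE]].
  { generalize (Cmod_ge_0 lam); lra. }
  destruct (HG 1%R Rlt_0_1) as [d1 [Hd1 H1]].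
  assert (HBK : (0 < (B + 1) * K)%R) by nra.
  intros e He.
  destruct (HG (e / 2)%R ltac:(lra)) as [d2 [Hd2 H2]].
  assert (He3 : (0 < e / (2 * ((B + 1) * K)))%R) by (apply Rdiv_lt_0_compat; lra).
  exists (Rmin (Rmin 1 d1) (Rmin d2 (e / (2 * ((B + 1) * K))))); split.
  { repeat apply Rmin_glb_lt; lra. }
  intros h Hh0 Hh x Ix.
  assert (Rabs h < 1 /\ Rabs h < d1 /\ Rabs h < d2 /\
    Rabs h < e / (2 * ((B + 1) * K)))%R as [B1 [B2 [B3 B4]]].
  { revert Hh; generalize (e / (2 * ((B + 1) * K)))%R; intros r.
    unfold Rmin; repeat destruct Rle_dec; lra. }
  assert (HUb : (Cmod (U h x) <= (B + 1) * K)%R).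
  { apply (HE (lam + h) (F h) (U h) (P h)); auto.
    - eapply Rle_trans; [apply Cmod_triangle |]; rewrite Cmod_R; lra.
    - lra.
    - intros t It; replace (F h t) with ((F h t - G t) + G t) by ring.
      eapply Rle_trans; [apply Cmod_triangle |].
      generalize (H1 h Hh0 B2 t It) (HGB t It); lra. }
  replace (F h x + (lam + h - lam) * U h x - G x)
    with ((F h x - G x) + h * U h x) by ring.
  eapply Rle_trans; [apply Cmod_triangle |]; rewrite Cmod_mult, Cmod_R.
  assert (A : (Rabs h * Cmod (U h x) <= e / (2 * ((B + 1) * K)) * ((B + 1) * K))%R).
  { apply Rmult_le_compat; try lra; [apply Rabs_pos | apply Cmod_ge_0]. }
  replace (e / (2 * ((B + 1) * K)) * ((B + 1) * K))%R with (e / 2)%R in A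
    by (field; nra).
  generalize (H2 h Hh0 B3 x Ix); lra.
Qed.

(** * Differentiation in the spectral parameter *)

Definition dquot (s : C -> R -> C) (lam : C) (h x : R) : C := (s (lam + h) x - s lam x) / h.

(* For real [h] the difference quotient in the parameter solves the equation at
   [lam + h] with source [s lam] plus the difference quotient of [g]. *)
Lemma sys_dquot (q : R -> R) (g s p : C -> R -> C) (g1 : R -> C) (lam al ga : C) :
  contI q ->
  (forall mu, sys q mu (g mu) (s mu) (p mu)) ->
  (forall mu, s mu 0%R = al) -> (forall mu, p mu 0%R = ga) ->
  uconv (dquot g lam) g1 ->
  (exists B : R, (0 <= B)%R /\ forall x, I01 x -> (Cmod (g1 x) <= B)%R) ->
  exists s1 p1 : R -> C, sys q lam (fun x => s lam x + g1 x) s1 p1 /\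
    s1 0%R = 0 /\ p1 0%R = 0 /\ uconv (dquot s lam) s1.
Proof.
  intros Hq HS Hs0 Hp0 Hg Hg1.
  destruct (sys_limit_shift q lam (fun h x => s lam x + dquot g lam h x)
    (dquot s lam) (dquot p lam) (fun x => s lam x + g1 x))
    as [s1 [p1 [H1 [H2 [H3 [H4 _]]]]]]; auto.
  - intros h Hh.
    assert (Hn := RtoC_neq_0 h Hh).
    eapply sys_ext.
    4: exact (sys_scal _ _ _ _ _ (/ h) (sys_minus _ _ _ _ _ _ _ _ (HS (lam + h))
      (sys_shift q lam (lam + h) _ _ _ (HS lam)))).
    1-3: intros t _; unfold dquot; simpl; field; exact Hn.
  - intros h Hh; unfold dquot; rewrite !Hs0; unfold Cdiv; ring.
  - intros h Hh; unfold dquot; rewrite !Hp0; unfold Cdiv; ring.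
  - intros e He; destruct (Hg e He) as [d [Hd H]]; exists d; split; [exact Hd |].
    intros h Hh0 Hh x Ix.
    replace (s lam x + dquot g lam h x - (s lam x + g1 x))
      with (dquot g lam h x - g1 x) by ring; auto.
  - destruct Hg1 as [B [HB Hb]].
    destruct (contI_bounded _ (sys_contI_u _ _ _ _ _ (HS lam))) as [B' [HB' Hb']].
    exists (B' + B)%R; split; [lra |].
    intros x Ix; eapply Rle_trans; [apply Cmod_triangle |].
    apply Rplus_le_compat; auto.
  - exists s1, p1; auto.
Qed.

(** [C_derive] takes the limits of the real and imaginary parts along the horizontal line through
    [lam], so difference quotients with real steps determine it. *)
Lemma C_derive_uconv (s : C -> R -> C) (lam : C) (s1 : R -> C) (x : R) :
  uconv (dquot s lam) s1 -> I01 x -> C_derive (fun mu => s mu x) lam = s1 x.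
Proof.
  intros H Ix; unfold C_derive, C_lim.
  assert (HL : forall pr : C -> R, (forall z, (Rabs (pr z) <= Cmod z)%R) ->
    (forall z z', pr (z - z') = (pr z - pr z')%R) ->
    Lim (fun r : R => pr ((s (r, snd lam) x - s lam x) / ((r, snd lam) - lam))) (fst lam)
    = Finite (pr (s1 x))).
  { intros pr Hpr Hm; apply is_lim_unique, is_lim_spec; intros eps.
    assert (He : (0 < eps / 2)%R) by (generalize (cond_pos eps); lra).
    destruct (H _ He) as [d [Hd HD]].
    exists (mkposreal d Hd); intros r Hr Hne.
    change (Rabs (r - fst lam) < d)%R in Hr.
    (* The point of the horizontal line with abscissa [r] is reached by the real step
       [r - fst lam]. *)
    assert (E1 : lam + (r - fst lam)%R = (r, snd lam)).
    { apply injective_projections; simpl; ring. }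
    assert (E2 : RtoC (r - fst lam) = (r, snd lam) - lam) by (rewrite <- E1; ring).
    assert (G := HD (r - fst lam)%R (Rminus_eq_contra _ _ Hne) Hr x Ix).
    unfold dquot in G; rewrite E1, E2 in G.
    rewrite <- Hm; eapply Rle_lt_trans; [apply Hpr |].
    apply Rle_lt_trans with (1 := G); generalize (cond_pos eps); lra. }
  rewrite (HL fst), (HL snd).
  - simpl; now destruct (s1 x).
  - apply Rabs_snd_Cmod.
  - reflexivity.
  - apply Rabs_fst_Cmod.
  - reflexivity.
Qed.

Lemma is_solution_sys (q : R -> R) (beta : R) (lam : C) (u : R -> C) :
  is_solution q beta lam u -> sys q lam (fun _ => 0) u (dx u).
Proof.
  intros [S1 S2 S3 S4 _ _].
  assert (E : forall v x, I01 x -> ex_dx v x -> dI v x (dx v x)).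
  { intros v x Ix [l Hl]; apply is_dx_dI in Hl.
    now rewrite (dx_dI v x l Ix Hl). }
  split.
  - intros x Ix; apply E; auto.
  - now apply contI_continuous_on.
  - intros x Hx.
    replace ((q x - lam) * u x - 0) with (dx (dx u) x).
    + apply E; [unfold I01; lra | auto].
    + specialize (S4 x Hx).
      replace ((q x - lam) * u x - 0) with (q x * u x - lam * u x) by ring.
      rewrite <- S4; ring.
  - exists 0%R; split; [lra |]; intros x _; rewrite Cmod_0; lra.
Qed.

(** Zero data at 1 would propagate back to 0 and make [sin beta] and [cos beta] vanish together. *)
Lemma solution_endpoint_neq_0 (q : R -> R) (beta : R) (lam : C) (u : R -> C) :
  continuous_on I01 q -> is_solution q beta lam u -> u 1%R = 0 -> dx u 1%R = 0 -> False.
Proof.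
  intros Hq H H1 H2.
  destruct (energy_backward q lam u (dx u)) as [Z1 Z2]; auto.
  - now apply contI_continuous_on.
  - now apply is_solution_sys with beta.
  - rewrite (sol_init _ _ _ _ H) in Z1; rewrite (sol_init' _ _ _ _ H) in Z2.
    apply (f_equal fst) in Z1, Z2; simpl in Z1, Z2.
    generalize (sin2_cos2 beta); rewrite Z1, Z2; unfold Rsqr; lra.
Qed.

Lemma parameter_derivatives_dI (q : R -> R) (beta : R) (y : R -> C -> C) (l0 : C) :
  continuous_on I01 q ->
  (forall lam, is_solution q beta lam (fun x => y x lam)) ->
  (exists l : C, dI (fun x => C_derive (y x) l0) 1 l) /\
  (exists l : C, dI (fun x => C_derive_n (y x) 2 l0) 1 l).
Proof.
  intros Hq0 HS.
  assert (Hq : contI q) by now apply contI_continuous_on.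
  assert (I0 : I01 0) by (unfold I01; lra).
  assert (I1 : I01 1) by (unfold I01; lra).
  set (s := fun (lam : C) x => y x lam).
  set (v := fun (lam : C) x => C_derive (y x) lam).
  assert (Sys : forall mu, sys q mu (fun _ => 0) (s mu) (dx (s mu))).
  { intros mu; now apply is_solution_sys with beta. }
  (* The first parameter derivative is needed at every [mu], since the second one is a limit of
     difference quotients of [v] in [mu]. Here the family of sources is 0, so [v mu] solves the
     system with source [s mu]. *)
  assert (V : forall mu, sys q mu (s mu) (v mu) (dx (v mu)) /\
    v mu 0%R = 0 /\ dx (v mu) 0%R = 0 /\ uconv (dquot s mu) (v mu)).
  { intros mu.
    destruct (sys_dquot q (fun _ _ => 0) s (fun lam => dx (s lam)) (fun _ => 0) mu
      (sin beta) (cos beta)) as [v1 [p1 [H1 [H2 [H3 H4]]]]]; auto.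
    - intros nu; apply (HS nu).
    - intros nu; apply (HS nu).
    - intros e He; exists 1%R; split; [lra |]; intros h Hh _ x _.
      unfold dquot; replace ((0 - 0) / h - 0) with (RtoC 0) by (unfold Cdiv; ring).
      rewrite Cmod_0; lra.
    - exists 0%R; split; [lra |]; intros x _; rewrite Cmod_0; lra.
    - assert (E : forall x, I01 x -> v1 x = v mu x).
      { intros x Ix; symmetry; exact (C_derive_uconv s mu v1 x H4 Ix). }
      assert (D : forall x, I01 x -> p1 x = dx (v mu) x).
      { intros x Ix; symmetry; apply dx_dI; [exact Ix |].
        apply dI_ext with v1; auto; now apply H1. }
      repeat match goal with |- _ /\ _ => split end.
      + apply sys_ext with (4 := H1); auto.
        intros t _; ring.
      + rewrite <- E; auto.
      + rewrite <- D; auto.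
      + intros e He; destruct (H4 e He) as [d [Hd H]]; exists d; split; [exact Hd |].
        intros h Hh0 Hh x Ix; rewrite <- E; auto. }
  destruct (V l0) as [V1 [_ [_ V4]]].
  (* Now the sources are [s mu], whose difference quotients tend to [v l0]; the second derivative
     [v2] therefore solves the system with source [2 v l0]. *)
  destruct (sys_dquot q s v (fun mu => dx (v mu)) (v l0) l0 0 0)
    as [v2 [p2 [H1 [_ [_ H4]]]]]; try (intros; apply V); auto.
  - apply contI_bounded, (sys_contI_u _ _ _ _ _ V1).
  - split.
    + exists (dx (v l0) 1%R); now apply V1.
    + exists (p2 1%R); apply dI_ext with v2; auto.
      * intros t It; symmetry; exact (C_derive_uconv v l0 v2 t H4 It).
      * now apply H1.
Qed.

(** * Algebra of the quantities A and the final equivalence *)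

Lemma frakA2_sharp_algebra (f0 f1 f2 C0 D0 w3 w4 w5 : C) :
  f0 <> 0 -> w3 <> 0 ->
  let A1h := f1 + (C0 + C0) * f0 in
  let A2h := f2 + (C0 + C0) * f1 + (D0 + D0 + C0 ^ 2) * f0 in
  let C2 := - ((A1h * (w3 / RtoC 6) + f0 * (w4 / RtoC 24)) / (f0 * (w3 / RtoC 6))) in
  let D1 := - ((A2h * (w3 / RtoC 6) + A1h * (w4 / RtoC 24) + f0 * (w5 / RtoC 120)
      - C2 ^ 2 * f0 * (w3 / RtoC 6)) / (f0 * (w3 / RtoC 6))) in
  f2 + (C0 + C2) * f1 + (D0 + C2 * C0 + D1) * f0 = 0 <->
  D0 = C0 ^ 2 + w4 / (RtoC 4 * w3) * (C0 + w4 / (RtoC 4 * w3)) - w5 / (RtoC 20 * w3).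
Proof.
  intros H0 H3 A1h A2h C2 D1.
  assert (N4 : RtoC 4 <> 0) by (apply RtoC_neq_0; lra).
  assert (N6 : RtoC 6 <> 0) by (apply RtoC_neq_0; lra).
  assert (N20 : RtoC 20 <> 0) by (apply RtoC_neq_0; lra).
  (* Factoring out 6 leaves 4, 6 and 20 as the only numerical denominators for [field]. *)
  assert (E24 : RtoC 24 = RtoC 6 * RtoC 4) by (rewrite <- RtoC_mult; f_equal; ring).
  assert (E120 : RtoC 120 = RtoC 6 * RtoC 20) by (rewrite <- RtoC_mult; f_equal; ring).
  set (rhs := C0 ^ 2 + _ - _).
  (* Once this factorization is known, [f0 <> 0] reduces the vanishing of the left side to
     [D0 = rhs]. *)
  assert (E : f2 + (C0 + C2) * f1 + (D0 + C2 * C0 + D1) * f0 = (rhs - D0) * f0).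
  { unfold rhs, D1, C2, A2h, A1h; rewrite E24, E120.
    field; repeat split; assumption. }
  rewrite E; split; intros H.
  - destruct (Ceq_dec (rhs - D0) 0) as [Z | Z].
    2: { exfalso; exact (Cmult_neq_0 _ _ Z H0 H). }
    replace D0 with (rhs - (rhs - D0)) by ring; rewrite Z; ring.
  - rewrite H at 1; ring.
Qed.

Lemma boundary_coefficient_neq_0 (a b c d : R) (l0 : C) :
  (a * d - b * c < 0)%R -> c * l0 + d = 0 -> a * l0 + b <> 0.
Proof.
  intros Hdet Hm Hn.
  assert (E : RtoC (a * d - b * c) = a * (c * l0 + d) - c * (a * l0 + b)).
  { rewrite RtoC_minus, !RtoC_mult; ring. }
  rewrite Hm, Hn in E; apply (f_equal fst) in E; simpl in E; lra.
Qed.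

(** [f1] and [f2] are the values at [K = M = 0]. The coefficient of [y0] in [u] must equal that of
    [y1] in [v]: the correction terms then regroup into [K] times [f1]. *)
Lemma frakA_combination (a b c d : R) (l0 : C) (y0 y1 y2 : R -> C) :
  (a * d - b * c < 0)%R ->
  (exists l, dI y0 1 l) -> (exists l, dI y1 1 l) -> (exists l, dI y2 1 l) ->
  exists f1 f2 : C,
  (forall K u, (forall x, u x = y1 x + K * y0 x) ->
    frakA1 a b c d l0 y0 u = f1 + K * frakA0 a b c d l0 y0) /\
  (forall K M u v, (forall x, u x = y1 x + K * y0 x) ->
    (forall x, v x = y2 x + K * y1 x + M * y0 x) ->
    frakA2 a b c d l0 y0 u v = f2 + K * f1 + M * frakA0 a b c d l0 y0).
Proof.
  intros Hdet [z0 Z0] [z1 Z1] [z2 Z2].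
  assert (I1 : I01 1) by (unfold I01; lra).
  exists (frakA1 a b c d l0 y0 y1), (frakA2 a b c d l0 y0 y1 y2).
  unfold frakA0, frakA1, frakA2; destruct (Ceq_dec (c * l0 + d) 0) as [Hm | Hm].
  - assert (Hn := boundary_coefficient_neq_0 a b c d l0 Hdet Hm).
    rewrite (dx_dI y0 1 z0 I1 Z0), (dx_dI y1 1 z1 I1 Z1), (dx_dI y2 1 z2 I1 Z2).
    (* In this branch A reads x-derivatives at 1, so linearity of [dx] rests on the
       differentiability hypotheses. *)
    assert (DU : forall K u, (forall x, u x = y1 x + K * y0 x) ->
      dx u 1%R = z1 + K * z0).
    { intros K u Hu; apply dx_dI; [exact I1 |].
      apply dI_ext with (fun x => y1 x + K * y0 x); auto.
      apply dI_plus; [exact Z1 | now apply dI_scal]. }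
    split.
    + intros K u Hu; rewrite (DU K u Hu); field; exact Hn.
    + intros K M u v Hu Hv; rewrite (DU K u Hu).
      assert (DV : dx v 1%R = z2 + K * z1 + M * z0).
      { apply dx_dI; [exact I1 |].
        apply dI_ext with (fun x => y2 x + K * y1 x + M * y0 x); auto.
        apply dI_plus; [apply dI_plus |]; [exact Z2 | now apply dI_scal |].
        now apply dI_scal. }
      rewrite DV; field; exact Hn.
  - split.
    + intros K u Hu; rewrite Hu; field; exact Hm.
    + intros K M u v Hu Hv; rewrite Hu, Hv; field; exact Hm.
Qed.

Theorem theorem3p3 :
  forall (q : R -> R) (a b c d beta : R) (y : R -> C -> C) (l0 C0 D0 : C),
    continuous_on I01 q ->
    (a * d - b * c < 0)%R ->
    (0 <= beta < PI)%R ->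
    (forall lambda : C, is_solution q beta lambda (fun x => y x lambda)) ->
    triple_eigenvalue (omega a b c d y) l0 ->
    let w (n : nat) : C := C_derive_n (omega a b c d y) n l0 in
    let y0 (x : R) : C := y x l0 in
    let y1t (x : R) : C := C_derive (y x) l0 in
    let y2t (x : R) : C := C_derive_n (y x) 2 l0 / RtoC 2 in
    let y1 (x : R) : C := y1t x + C0 * y0 x in
    let y2 (x : R) : C := y2t x + C0 * y1t x + D0 * y0 x in
    let y1h (x : R) : C := y1 x + C0 * y0 x in
    let y2h (x : R) : C := y2 x + C0 * y1 x + D0 * y0 x in
    let A0 : C := frakA0 a b c d l0 y0 in
    let A1h : C := frakA1 a b c d l0 y0 y1h in
    let A2h : C := frakA2 a b c d l0 y0 y1h y2h in
    let C2 : C :=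
      - ((A1h * (w 3%nat / RtoC 6) + A0 * (w 4%nat / RtoC 24))
         / (A0 * (w 3%nat / RtoC 6))) in
    let D1 : C :=
      - ((A2h * (w 3%nat / RtoC 6) + A1h * (w 4%nat / RtoC 24)
          + A0 * (w 5%nat / RtoC 120) - C2 ^ 2 * A0 * (w 3%nat / RtoC 6))
         / (A0 * (w 3%nat / RtoC 6))) in
    let y1s (x : R) : C := y1 x + C2 * y0 x in
    let y2star (x : R) : C := y2 x + C2 * y1 x in
    let y2s (x : R) : C := y2star x + D1 * y0 x in
    frakA2 a b c d l0 y0 y1s y2s = 0
    <->
    D0 = C0 ^ 2
         + w 4%nat / (RtoC 4 * w 3%nat) * (C0 + w 4%nat / (RtoC 4 * w 3%nat))
         - w 5%nat / (RtoC 20 * w 3%nat).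
Proof.
  intros q a b c d beta y l0 C0 D0 Hq Hdet _ HS [Hw0 [_ [_ Hw3]]].
  intros w y0 y1t y2t y1 y2 y1h y2h A0 A1h A2h C2 D1 y1s y2star y2s.
  assert (I1 : I01 1) by (unfold I01; lra).
  destruct (parameter_derivatives_dI q beta y l0 Hq HS) as [Z1 [z2 Z2]].
  destruct (frakA_combination a b c d l0 y0 y1t y2t Hdet) as [f1 [f2 [F1 F2]]].
  { exists (dx y0 1); apply (is_solution_sys q beta l0 y0 (HS l0)); exact I1. }
  { exact Z1. }
  { exists (/ RtoC 2 * z2).
    apply dI_ext with (fun x => / RtoC 2 * C_derive_n (y x) 2 l0); [exact I1 | |].
    - intros t _; unfold y2t, Cdiv; ring.
    - now apply dI_scal. }
  assert (HA0 : A0 <> 0).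
  (* If A(y0) were 0, one of [y0(1)], [y0'(1)] would vanish; [omega = 0] at [l0] then kills the
     other, whose coefficient is nonzero in that branch. *)
  { assert (Hend := solution_endpoint_neq_0 q beta l0 y0 Hq (HS l0)).
    unfold omega in Hw0; fold y0 in Hw0; change (y 1%R l0) with (y0 1%R) in Hw0.
    unfold A0, frakA0; destruct (Ceq_dec (c * l0 + d) 0) as [Hm | Hm]; intros H.
    - assert (Hn := boundary_coefficient_neq_0 a b c d l0 Hdet Hm).
      assert (H1 : dx y0 1%R = 0).
      { replace (dx y0 1%R) with (dx y0 1%R / (a * l0 + b) * (a * l0 + b))
          by (field; exact Hn).
        rewrite H; ring. }
      apply Hend; [| exact H1].
      rewrite H1, Hm in Hw0.
      replace (y0 1%R) with (((a * l0 + b) * y0 1%R - 0 * 0) / (a * l0 + b))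
        by (field; exact Hn).
      rewrite Hw0; unfold Cdiv; ring.
    - assert (H1 : y0 1%R = 0).
      { replace (y0 1%R) with (y0 1%R / (c * l0 + d) * (c * l0 + d))
          by (field; exact Hm).
        rewrite H; ring. }
      apply Hend; [exact H1 |].
      rewrite H1 in Hw0.
      replace (dx y0 1%R) with
        (- ((a * l0 + b) * 0 - (c * l0 + d) * dx y0 1%R) / (c * l0 + d))
        by (field; exact Hm).
      rewrite Hw0; unfold Cdiv; ring. }
  (* The hat functions apply [C0] and [D0] twice, whence [2 C0], and [2 D0 + C0 ^ 2] as coefficient
     of [y0] in [y2h]. *)
  assert (E1 : A1h = f1 + (C0 + C0) * A0).
  { apply F1; intros x; unfold y1h, y1; ring. }
  assert (E2 : A2h = f2 + (C0 + C0) * f1 + (D0 + D0 + C0 ^ 2) * A0).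
  { apply F2; intros x; unfold y2h, y1h, y2, y1; ring. }
  (* These are the coefficients of the sharp functions in terms of [y0], [y1t], [y2t]. *)
  rewrite (F2 (C0 + C2) (D0 + C2 * C0 + D1) y1s y2s).
  - fold A0; unfold D1, C2; rewrite E1, E2.
    apply frakA2_sharp_algebra; assumption.
  - intros x; unfold y1s, y1; ring.
  - intros x; unfold y2s, y2star, y2, y1; ring.
Qed.
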